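(* Let $n\geq 2$ and let $K_{n\times 2}$ be the cocktail party graph on $2n$ vertices. Then the Lanzhou spectrum of $K_{n\times 2}$ consists of $0$ with multiplicity $n$, $-8(n-1)$ with multiplicity $n-1$, and $8(n-1)^2$ with multiplicity $1$. Moreover, $In(A_{Lz}(K_{n\times 2}))=(1,n-1,n)$.
   Context: Graphs are finite, simple and undirected. For a graph $G$ on $N$ vertices, $d_G(u)$ is the degree of $u$ in $G$ and $d_{\overline{G}}(u)=N-1-d_G(u)$ is its degree in the complement $\overline{G}$. The Lanzhou matrix $A_{Lz}(G)$ is the real symmetric $N\times N$ matrix indexed by vertices whose $(u,v)$ entry is $d_G(u)d_{\overline{G}}(u)+d_G(v)d_{\overline{G}}(v)$ if $u$ and $v$ are adjacent in $G$, and $0$ otherwise. The Lanzhou spectrum of $G$ is the multiset of eigenvalues of $A_{Lz}(G)$. The inertia $In(M)=(n_+,n_-,n_0)$ of a real symmetric matrix $M$ gives its numbers of positive, negative and zero eigenvalues (with multiplicity). $K_{n\times 2}$ is the complete multipartite graph with $n$ parts, each of size $2$. *)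

(* Defs.v *)
From HB Require Import structures.
From mathcomp Require Import all_boot all_order all_algebra.
From mathcomp Require Import polyrcf.
From mathcomp Require Import reals.

Set Implicit Arguments.
Unset Strict Implicit.
Unset Printing Implicit Defensive.

Import Order.TTheory GRing.Theory Num.Theory.
Local Open Scope ring_scope.

Record sgraph := SGraph {
  vertex :> finType;
  adj : rel vertex;
  adj_sym : symmetric adj;
  adj_irrefl : irreflexive adj
}.

Definition deg (G : sgraph) (u : G) : nat := #|[set v : G | adj u v]|.

Section Complement.
Variable G : sgraph.

Definition compl_adj : rel G := fun u v => (u != v) && ~~ adj u v.

Lemma compl_adj_sym : symmetric compl_adj.
Proof. by move=> u v; rewrite /compl_adj eq_sym adj_sym. Qed.

Lemma compl_adj_irrefl : irreflexive compl_adj.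
Proof. by move=> u; rewrite /compl_adj eqxx. Qed.

Definition compl : sgraph := SGraph compl_adj_sym compl_adj_irrefl.

End Complement.

Lemma deg_compl (G : sgraph) (u : G) :
  @deg (compl G) u = (#|G| - 1 - deg u)%N.
Proof.
have -> : @deg (compl G) u = #|~: (u |: [set v : G | adj u v])|.
  by apply: eq_card => v; rewrite !inE /= /compl_adj negb_or eq_sym.
by rewrite cardsCs setCK cardsU1 inE adj_irrefl subnDA.
Qed.

(* Vertices are numbered by the enumeration of their finite type. *)
Definition lanzhou_mx (R : realType) (G : sgraph) : 'M[R]_#|G| :=
  \matrix_(i, j)
    let u : G := enum_val i in
    let v : G := enum_val j in
    if adj u v
    then (deg u * @deg (compl G) u + deg v * @deg (compl G) v)%:R
    else 0.

(* Eigenvalues in R, repeated according to their multiplicity as roots of the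
   characteristic polynomial.  The list enumerates a multiset, to be compared
   up to [perm_eq]; when M is symmetric it has exactly N elements. *)
Definition spectrum (R : realType) (N : nat) (M : 'M[R]_N) : seq R :=
  flatten [seq nseq (mup x (char_poly M)) x | x <- rootsR (char_poly M)].

Lemma count_spectrum (R : realType) (N : nat) (M : 'M[R]_N) (x : R) :
  count_mem x (spectrum M) = mup x (char_poly M).
Proof.
set p := char_poly M.
have p0 : p != 0 by apply: monic_neq0; exact: char_poly_monic.
have xE : (x \in rootsR p) = root p x by rewrite -(roots_on_rootsR p0) in_itv.
have cE (s : seq R) : uniq s ->
    count_mem x (flatten [seq nseq (mup y p) y | y <- s])
    = ((x \in s) * mup x p)%N.
  elim: s => //= y s IHs /andP[yNs us].
  rewrite count_cat IHs // count_nseq in_cons /= [y == x]eq_sym.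
  have [->|_] := eqVneq x y; last by rewrite mul0n.
  by rewrite (negbTE yNs) addn0.
rewrite cE ?uniq_roots // xE; case: (boolP (root p x)) => [_|px].
  by rewrite mul1n.
by rewrite mul0n mupNroot.
Qed.

(* (n_+, n_-, n_0) *)
Definition inertia (R : realType) (N : nat) (M : 'M[R]_N) : nat * nat * nat :=
  (count (fun x => 0 < x) (spectrum M),
   count (fun x => x < 0) (spectrum M),
   count (fun x => x == 0) (spectrum M)).

Section CompleteMultipartite.
Variables n m : nat.

(* n parts of size m: (i, a) is the a-th vertex of the i-th part. *)
Definition multipartite_adj : rel ('I_n * 'I_m) := fun u v => u.1 != v.1.

Lemma multipartite_adj_sym : symmetric multipartite_adj.
Proof. by move=> u v; rewrite /multipartite_adj eq_sym. Qed.

Lemma multipartite_adj_irrefl : irreflexive multipartite_adj.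
Proof. by move=> u; rewrite /multipartite_adj eqxx. Qed.

Definition complete_multipartite : sgraph :=
  SGraph multipartite_adj_sym multipartite_adj_irrefl.

End CompleteMultipartite.

Definition cocktail_party (n : nat) : sgraph := complete_multipartite n 2.

(* Main.v *)
Require Import Defs.
From mathcomp Require Import all_boot all_order all_algebra.
From mathcomp Require Import ring.
From mathcomp Require Import reals.

Import Order.TTheory GRing.Theory Num.Theory.
Local Open Scope ring_scope.

(** The Lanzhou matrix of [K_{n x 2}] factors as [A K A^T], where [A] is the
    vertex/part incidence matrix and [K = c (J - I)] with [c = 4(n - 1)].
    Since [A^T A = 2 I], exchanging the factors shows that, up to [n] zeros,
    its spectrum is that of the [n x n] matrix [2K], a shift of the rank-one
    matrix [2cJ]; exchanging the factors of [J = 1 1^T] computes the latter. *)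

(* Both sides are the determinant of [[x I, A], [B, I]], multiplied by [x ^+ n]:
   one eliminates [B] using the block [I], or using [x I] after scaling. *)
Lemma det_scalar_sub_mulmxC (R : comNzRingType) (m n : nat) (x : R)
    (A : 'M[R]_(m, n)) (B : 'M[R]_(n, m)) :
  x ^+ n * \det (x%:M - A *m B) = x ^+ m * \det (x%:M - B *m A).
Proof.
have <- : \det (block_mx x%:M A B 1%:M) = \det (x%:M - A *m B).
  have det1L : \det (block_mx 1%:M 0 (- B) 1%:M : 'M_(m + n)) = 1.
    by rewrite det_lblock !det1 mulr1.
  rewrite -[LHS]mulr1 -[X in _ * X]det1L.
  rewrite -det_mulmx mulmx_block !mulmx1 !mulmx0 !add0r mul1mx mulmxN subrr.
  by rewrite det_ublock det1 mulr1.
have -> : x ^+ n = \det (block_mx 1%:M 0 (- B) x%:M : 'M_(m + n)).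
  by rewrite det_lblock det1 mul1r det_scalar.
rewrite -det_mulmx mulmx_block !mulmx1 !mul0mx !mul1mx !addr0 mulNmx.
rewrite mul_mx_scalar mul_scalar_mx addNr det_ublock det_scalar.
by rewrite mulNmx addrC.
Qed.

Lemma char_poly_mulmxC (R : comNzRingType) (m n : nat)
    (A : 'M[R]_(m, n)) (B : 'M[R]_(n, m)) :
  'X^n * char_poly (A *m B) = 'X^m * char_poly (B *m A).
Proof. by rewrite /char_poly /char_poly_mx !map_mxM det_scalar_sub_mulmxC. Qed.

(** Substituting ['X + a] for ['X] is a ring morphism, so it commutes with the determinant and acts
    entrywise on the characteristic matrix. *)
Lemma char_poly_sub_scalar (R : comNzRingType) (n : nat) (A : 'M[R]_n) (a : R) :
  char_poly (A - a%:M) = char_poly A \Po ('X + a%:P).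
Proof.
rewrite /char_poly -det_map_mx; congr (\det _); apply/matrixP => i j.
rewrite !mxE /= comp_polyB comp_polyC [in RHS]raddfMn /= comp_polyX.
by rewrite polyCB polyCMn mulrnDl; ring.
Qed.

(** The matrix is a column times a row; the reversed product is 1 x 1 with entry [a *+ n.+1]. *)
Lemma char_poly_const_mx (R : idomainType) (n : nat) (a : R) :
  char_poly (const_mx a : 'M[R]_n.+1) = 'X^n * ('X - (a *+ n.+1)%:P).
Proof.
have -> : const_mx a
    = (const_mx 1 : 'M[R]_(n.+1, 1)) *m (const_mx a : 'M[R]_(1, n.+1)).
  by apply/matrixP => i j; rewrite !mxE big_ord1 !mxE mul1r.
have X0 : 'X^1 != 0 :> {poly R} by rewrite monic_neq0 ?monicXn.
apply: (mulfI X0); rewrite char_poly_mulmxC mulrA -exprS; congr (_ * _).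
rewrite /char_poly det_mx11 !mxE mulr1n; congr ('X - _%:P).
under eq_bigr do rewrite !mxE mulr1.
by rewrite sumr_const card_ord.
Qed.

(** Each value occurs in either list as often as its multiplicity as a root of the characteristic
    polynomial. *)
Lemma spectrum_prod_XsubC (R : realType) (N : nat) (M : 'M[R]_N) (s : seq R) :
  char_poly M = \prod_(x <- s) ('X - x%:P) -> perm_eq (spectrum M) s.
Proof.
move=> cM; apply/allP => x _ /=; apply/eqP.
by rewrite count_spectrum cM mu_prod_XsubC.
Qed.

Lemma deg_complete_multipartite (n m : nat) (u : complete_multipartite n m) :
  deg u = (n.-1 * m)%N.
Proof.
rewrite /deg (eq_card (B := [predX predC1 u.1 & predT])).
  by rewrite cardX cardC1 !card_ord.
by move=> v; rewrite !inE /= /multipartite_adj eq_sym andbT.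
Qed.

Definition part_incidence_mx (R : nzRingType) (n m : nat) :
    'M[R]_(#|complete_multipartite n m|, n) :=
  \matrix_(i, k)
    ((enum_val i : complete_multipartite n m).1 == k)%:R.

(** The columns are the indicator vectors of disjoint parts of size [m]. *)
Lemma part_incidence_tr_mul (R : nzRingType) (n m : nat) :
  (part_incidence_mx R n m)^T *m part_incidence_mx R n m = m%:R%:M.
Proof.
apply/matrixP => k l; rewrite !mxE.
under eq_bigr do rewrite !mxE -natrM mulnb.
rewrite -(reindex _ (P := predT)
  (F := fun u : complete_multipartite n m => ((u.1 == k) && (u.1 == l))%:R)
  (onW_bij _ (@enum_val_bij _))) /=.
rewrite -(pair_big predT predT
  (fun a (b : 'I_m) => ((a == k) && (a == l))%:R)) /=.
rewrite (bigD1 k) //= [X in _ + X]big1 => [|a /negbTE ak]; last first.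
  by rewrite big1 // => b _; rewrite ak.
rewrite eqxx sumr_const card_ord addr0.
by case: eqP => _; rewrite ?mul0rn.
Qed.

(** Every vertex has degree [2 * n] and codegree 1, so all edges weigh [4 * n], and adjacency
    depends only on the parts. *)
Lemma lanzhou_cocktail_party (R : realType) (n : nat) :
  lanzhou_mx R (cocktail_party n.+1) =
  part_incidence_mx R n.+1 2
    *m ((const_mx (4 * n)%:R - (4 * n)%:R%:M) *m (part_incidence_mx R n.+1 2)^T).
Proof.
apply/matrixP => i j; rewrite !mxE.
set u : cocktail_party n.+1 := enum_val i.
set v : cocktail_party n.+1 := enum_val j.
(* Both sums of the triple product collapse to the parts of [u] and [v]. *)
rewrite (bigD1 u.1) //= big1 => [|k /negbTE ku]; last first.
  by rewrite mxE eq_sym ku mul0r.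
rewrite !mxE (bigD1 v.1) //= big1 => [|k]; last first.
  by rewrite eq_sym !mxE => /negbTE ->; rewrite mulr0.
rewrite !mxE !eqxx mul1r mulr1 !addr0 !deg_compl !deg_complete_multipartite.
rewrite /adj /= /multipartite_adj card_prod !card_ord /=.
have -> : (n.+1 * 2 - 1 - n * 2 = 1)%N by rewrite mulSn -subnDA subnDr.
rewrite !muln1 -mulnDr [(n * 4)%N]mulnC.
by case: eqP => _; rewrite ?subrr ?subr0.
Qed.

Theorem theorem34 (R : realType) (n : nat) (hn : (2 <= n)%N) :
  perm_eq (spectrum (lanzhou_mx R (cocktail_party n)))
    (nseq n 0
     ++ nseq (n - 1) (- (8%:R * (n%:R - 1)))
     ++ nseq 1 (8%:R * (n%:R - 1) ^+ 2))
  /\ inertia (lanzhou_mx R (cocktail_party n)) = (1%N, (n - 1)%N, n).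
Proof.
set s := (X in perm_eq _ X).
have specM : perm_eq (spectrum (lanzhou_mx R (cocktail_party n))) s.
  apply: spectrum_prod_XsubC; rewrite {}/s.
  case: n hn => // k _; rewrite lanzhou_cocktail_party.
  set A := part_incidence_mx R k.+1 2; set c : R := (4 * k)%:R.
  have X0 : 'X^(k.+1) != 0 :> {poly R} by rewrite monic_neq0 ?monicXn.
  apply: (mulfI X0); rewrite char_poly_mulmxC -mulmxA part_incidence_tr_mul.
  have -> : (const_mx c - c%:M) *m 2%:R%:M
      = const_mx (2 * c) - (2 * c)%:M :> 'M[R]_k.+1.
    by rewrite mul_mx_scalar scalerBr scale_scalar_mx scalemx_const.
  rewrite char_poly_sub_scalar char_poly_const_mx card_prod !card_ord.
  rewrite !big_cat !big_nseq !iter_mulr_1 subr0 subn1 /=.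
  (* Of the [2 * k.+1] factors ['X], half cancel against the factor introduced above; the rest are
     the zero eigenvalues. *)
  rewrite muln2 -addnn exprD -mulrA; congr (_ * (_ * _)).
  rewrite rmorphM rmorphXn rmorphB /= comp_polyX comp_polyC.
  have -> : k.+1%:R - 1 = k%:R :> R by rewrite -natr1 addrK.
  (* With [c = 4 * k], the shift by [2 * c] turns the root 0 into [- 8 * k] and the root
     [2 * c * k.+1] into [2 * c * k], that is [8 * k ^+ 2]. *)
  congr (_ ^+ _ * _).
    by rewrite -polyCN opprK; congr ('X + _%:P); rewrite /c natrM; ring.
  rewrite expr1 -addrA -!polyCN -polyCD; congr ('X + _%:P).
  by rewrite /c natrM -mulr_natr; ring.
split=> //; rewrite /inertia !(permP specM) /s !count_cat !count_nseq /=.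
(* Since [n] is at least 2, the two nonzero values have strict, opposite signs. *)
have n1_gt0 : 0 < n%:R - 1 :> R by rewrite subr_gt0 ltr1n.
have lam_gt0 : 0 < 8%:R * (n%:R - 1) :> R by rewrite mulr_gt0.
have mu_gt0 : 0 < 8%:R * (n%:R - 1) ^+ 2 :> R by rewrite mulr_gt0 ?exprn_gt0.
rewrite ltxx eqxx oppr_gt0 oppr_lt0 oppr_eq0 lam_gt0 mu_gt0.
rewrite (gt_eqF lam_gt0) (gt_eqF mu_gt0) (lt_gtF lam_gt0) (lt_gtF mu_gt0).
by rewrite !mul0n !mul1n !addn0.
Qed.
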